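(* Let $\mathcal F$ be the Fano plane with point set $\mathbb Z_7$ and the seven lines $\phi(j)=\{j+1,j+2,j+4\}$, $j\in\mathbb Z_7$. Let $D$ be the digraph whose vertices are the $7$-tuples $(x,b_1,c_1,b_2,c_2,b_0,c_0)$ of points of $\mathcal F$, written $(x,b_1c_1,b_2c_2,b_0c_0)$, such that the three sets $\{x,b_1,c_1\}$, $\{x,b_2,c_2\}$, $\{x,b_0,c_0\}$ are the three distinct lines of $\mathcal F$ through $x$ and the set $\{b_1,b_2,b_0\}$ is a line of $\mathcal F$. There is an arc from $(x,b_1c_1,b_2c_2,b_0c_0)$ to $(x',b'_1c'_1,b'_2c'_2,b'_0c'_0)$ if and only if there exists $i\in\{0,1,2\}$ such that, with indices taken modulo $3$, $$x=c'_i,\quad x'=c_i,\quad b'_i=b_i,\quad b'_{i+1}=c_{i+1},\quad b'_{i-1}=c_{i-1},\quad c'_{i+1}=b_{i-1},\quad c'_{i-1}=b_{i+1}.$$ Then $D$ is a strongly connected oriented graph on $168$ vertices, every vertex of $D$ has indegree $3$ and outdegree $3$, $D$ has no directed cycles of length $2$ or $3$, $D$ has exactly $126$ directed $4$-cycles and these are pairwise arc-disjoint, and $D$ is $\vec{C}_4$-ultrahomogeneous.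
   Context: A digraph $G$ is called $H$-ultrahomogeneous ($H$-UH), for a digraph $H$, if every isomorphism between two induced subdigraphs of $G$ that are isomorphic to $H$ extends to an automorphism of $G$. Here $\vec{C}_4$ denotes the directed (oriented) cycle of length $4$. An oriented graph is a digraph with no loops and no pair of opposite arcs. *)

(* Defs.v *)
From mathcomp Require Import all_boot all_algebra.
Set Implicit Arguments.
Unset Strict Implicit.
Unset Printing Implicit Defensive.
Import GRing.Theory.
Local Open Scope ring_scope.

(* A finite digraph is a relation [e : rel T] on a finType; [e x y] is the arc
   from [x] to [y]. *)
Definition oriented (T : finType) (e : rel T) : Prop :=
  irreflexive e /\ forall x y, e x y -> ~~ e y x.

Definition strongly_connected (T : finType) (e : rel T) : Prop :=
  forall x y, connect e x y.

Definition outdegree (T : finType) (e : rel T) (x : T) : nat :=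
  #|[set y | e x y]|.

Definition indegree (T : finType) (e : rel T) (x : T) : nat :=
  #|[set y | e y x]|.

(* A directed cycle is identified with its set of arcs, so that the rotations
   of a cyclic sequence of vertices yield one and the same cycle. *)
Definition cycle_arcs (T : finType) (s : seq T) : {set T * T} :=
  [set (x, next s x) | x in s].

Definition dicycles (T : finType) (e : rel T) (n : nat) : {set {set T * T}} :=
  [set cycle_arcs t | t : n.-tuple T & ucycleb e t].

Definition digraph_iso (T U : finType) (e : rel T) (h : rel U) (f : T -> U) :
  Prop := bijective f /\ forall x y, h (f x) (f y) = e x y.

Definition isomorphic (T U : finType) (e : rel T) (h : rel U) : Prop :=
  exists f : T -> U, digraph_iso e h f.

Definition induced (T : finType) (e : rel T) (A : {set T}) :
  rel {x : T | x \in A} := fun x y => e (val x) (val y).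

Definition ultrahomogeneous (U T : finType) (h : rel U) (e : rel T) : Prop :=
  forall A B : {set T},
    isomorphic (@induced T e A) h -> isomorphic (@induced T e B) h ->
  forall f : {x : T | x \in A} -> {x : T | x \in B},
    digraph_iso (@induced T e A) (@induced T e B) f ->
  exists2 g : T -> T, digraph_iso e e g & forall x, g (val x) = val (f x).

Definition dicycle4 : rel 'Z_4 := fun i j => j == i + 1.

Definition fano_line (j : 'Z_7) : {set 'Z_7} := [set j + 1; j + 2; j + 4].

Definition fano_lines : {set {set 'Z_7}} := [set fano_line j | j : 'Z_7].

(* The entries of a 7-tuple are listed as (x, b1, c1, b2, c2, b0, c0). *)
Definition tuple7 : Type :=
  'Z_7 * 'Z_7 * 'Z_7 * 'Z_7 * 'Z_7 * 'Z_7 * 'Z_7.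

Definition is_vertex (t : tuple7) : bool :=
  let: (x, b1, c1, b2, c2, b0, c0) := t in
  let ls := [:: [set x; b1; c1]; [set x; b2; c2]; [set x; b0; c0]] in
  [&& uniq ls,
      [set:: ls] == [set l in fano_lines | x \in l]
    & [set b1; b2; b0] \in fano_lines].

Definition vertex : finType := {t : tuple7 | is_vertex t}.

Definition vx (v : vertex) : 'Z_7 :=
  let: (x, _, _, _, _, _, _) := val v in x.

Definition vb (v : vertex) (i : 'Z_3) : 'Z_7 :=
  let: (_, b1, _, b2, _, b0, _) := val v in tnth [tuple b0; b1; b2] i.

Definition vc (v : vertex) (i : 'Z_3) : 'Z_7 :=
  let: (_, _, c1, _, c2, _, c0) := val v in tnth [tuple c0; c1; c2] i.

Definition arcD : rel vertex := fun v v' =>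
  [exists i : 'Z_3,
    [&& vx v == vc v' i,
        vx v' == vc v i,
        vb v' i == vb v i,
        vb v' (i + 1) == vc v (i + 1),
        vb v' (i - 1) == vc v (i - 1),
        vc v' (i + 1) == vb v (i - 1)
      & vc v' (i - 1) == vb v (i + 1)]].

(* Main.v *)
Require Import Defs.
From mathcomp Require Import all_boot all_algebra.
Set Implicit Arguments.
Unset Strict Implicit.
Unset Printing Implicit Defensive.
Import GRing.Theory.
Local Open Scope ring_scope.

(* An arc of D only permutes the seven positions of a tuple: D is the functional
   graph of three permutations [step i] of the vertices, each induced by a
   permutation of positions of order 4. Hence any relabelling of the points of
   the Fano plane commutes with the [step i], and since the [step i] generate a
   transitive group (checked by enumeration), relabellings act transitively on
   the vertices. The short closed walks can therefore be read off at a single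
   base vertex: those of length at most 4 are the orbits of the [step i], which are
   the directed 4-cycles and partition the 168 * 3 arcs.
   Rotating the indices 0, 1, 2 conjugates [step i] to [step (i + 1)]; combined
   with relabellings it moves any vertex on an i-cycle to any vertex on a
   j-cycle, which is ultrahomogeneity. *)

(** * Tuples over an arbitrary type and permutations of their positions *)

Definition tuple7_of (T : Type) : Type := T * T * T * T * T * T * T.

(* The head of the arc of index [i] leaving [t], obtained by solving the seven
   equations defining an arc. *)
Definition succ7 (T : Type) (i : nat) (t : tuple7_of T) : tuple7_of T :=
  let: (x, b1, c1, b2, c2, b0, c0) := t in
  match i with
  | 0 => (c0, c1, b2, c2, b1, b0, x)
  | 1 => (c1, b1, x, c2, b0, c0, b2)
  | _ => (c2, c1, b0, b2, x, c0, b1)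
  end.

Definition map7 (T U : Type) (f : T -> U) (t : tuple7_of T) : tuple7_of U :=
  let: (x, b1, c1, b2, c2, b0, c0) := t in
  (f x, f b1, f c1, f b2, f c2, f b0, f c0).

(** Naturality: [succ7] moves positions and never inspects entries. Polymorphism lets it act both on
    points of the plane and on plain numbers. *)
Lemma map7_succ7 (T U : Type) (f : T -> U) i t :
  map7 f (succ7 i t) = succ7 i (map7 f t).
Proof.
by case: t => [[[[[[x b1] c1] b2] c2] b0] c0]; case: i => [|[|]].
Qed.

Definition seq7 (T : Type) (t : tuple7_of T) : seq T :=
  let: (x, b1, c1, b2, c2, b0, c0) := t in [:: x; b1; c1; b2; c2; b0; c0].

Lemma seq7_inj (T : Type) : injective (@seq7 T).
Proof.
move=> [[[[[[x b1] c1] b2] c2] b0] c0] [[[[[[x' b1'] c1'] b2'] c2'] b0'] c0'].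
by case=> -> -> -> -> -> -> ->.
Qed.

Lemma seq7_map (T U : Type) (f : T -> U) t : seq7 (map7 f t) = map f (seq7 t).
Proof. by case: t => [[[[[[x b1] c1] b2] c2] b0] c0]. Qed.

Lemma size_seq7 (T : Type) (t : tuple7_of T) : size (seq7 t) = 7%N.
Proof. by case: t => [[[[[[x b1] c1] b2] c2] b0] c0]. Qed.

(** * The Fano plane and the vertex condition in computable form *)

Definition fano_seq (j : nat) : seq nat :=
  [:: (j + 1) %% 7; (j + 2) %% 7; (j + 4) %% 7]%N.

Definition eq_mem_seq (T : eqType) (s1 s2 : seq T) : bool :=
  all (mem s2) s1 && all (mem s1) s2.

Definition fano_seqs : seq (seq nat) := map fano_seq (iota 0 7).

Definition is_line (s : seq nat) : bool := has (eq_mem_seq s) fano_seqs.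

(* [is_vertex] on plain numbers, where it evaluates. *)
Definition is_frame (t : tuple7_of nat) : bool :=
  let: (x, b1, c1, b2, c2, b0, c0) := t in
  let ls := [:: [:: x; b1; c1]; [:: x; b2; c2]; [:: x; b0; c0]] in
  [&& pairwise (fun l l' => ~~ eq_mem_seq l l') ls,
      all is_line ls,
      all (fun l : seq nat => (x \in l) ==> has (eq_mem_seq l) ls) fano_seqs
    & is_line [:: b1; b2; b0]].

Lemma set3E (T : finType) (a b c : T) : [set a; b; c] = [set:: [:: a; b; c]].
Proof. by apply/setP=> z; rewrite !inE orbA. Qed.

Lemma eq_mem_seqP (T : finType) (s1 s2 : seq T) :
  ([set:: s1] == [set:: s2]) = eq_mem_seq s1 s2.
Proof.
apply/eqP/andP => [eqs | [/allP s12 /allP s21]].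
  by split; apply/allP=> z; have /setP/(_ z) := eqs; rewrite !inE => /= ->.
apply/setP=> z; rewrite !inE; apply/idP/idP; [exact: s12 | exact: s21].
Qed.

Lemma eq_mem_seq_map (T U : eqType) (f : T -> U) (s1 s2 : seq T) :
  injective f -> eq_mem_seq (map f s1) (map f s2) = eq_mem_seq s1 s2.
Proof.
move=> f_inj; rewrite /eq_mem_seq !all_map; congr (_ && _);
  by apply: eq_all => z /=; rewrite mem_map.
Qed.

Lemma fano_lineE (s : seq 'Z_7) (j : 'Z_7) :
  ([set:: s] == fano_line j) = eq_mem_seq (map val s) (fano_seq j).
Proof.
rewrite /fano_line set3E eq_mem_seqP -(eq_mem_seq_map _ _ val_inj).
by congr eq_mem_seq; case: j => [[|[|[|[|[|[|[|]]]]]]]].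
Qed.

Lemma mem_fano_line (x j : 'Z_7) : (x \in fano_line j) = (val x \in fano_seq j).
Proof.
rewrite /fano_line set3E inE -(mem_map val_inj).
by case: j => [[|[|[|[|[|[|[|]]]]]]]].
Qed.

Lemma mem_fano_lines (s : seq 'Z_7) :
  ([set:: s] \in fano_lines) = is_line (map val s).
Proof.
rewrite /is_line /fano_seqs has_map; apply/imsetP/hasP => [[j _ /eqP] | [j]].
  by rewrite fano_lineE => eqj; exists (val j); rewrite // mem_iota ltn_ord.
rewrite mem_iota => ltj7 eqj; exists (Ordinal ltj7) => //.
by apply/eqP; rewrite fano_lineE.
Qed.

(** The two conjuncts are the two inclusions: every listed set is a line, and every line through [x]
    is listed. *)
Lemma fano_pencilE (x : 'Z_7) (ls : seq (seq 'Z_7)) :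
  all (fun l : seq _ => x \in l) ls ->
  ([set:: map (fun l => [set:: l]) ls] == [set l in fano_lines | x \in l]) =
  all is_line (map (map val) ls) &&
  all (fun l : seq nat => (val x \in l) ==> has (eq_mem_seq l) (map (map val) ls))
    fano_seqs.
Proof.
move=> /allP xls; rewrite eqEsubset; congr (_ && _).
  rewrite all_map; apply/subsetP/allP => /= [sub l lls | sub L].
    have := sub [set:: l]; rewrite !inE map_f // -mem_fano_lines.
    by move=> /(_ isT)/andP[].
  rewrite inE => /mapP[l lls ->].
  by rewrite !inE mem_fano_lines sub //= xls.
apply/subsetP/allP => [sub _ /mapP[j + ->] | sub L].
  rewrite mem_iota => ltj7 /=; apply/implyP=> xj.
  have jx : fano_line (Ordinal ltj7) \in [set l in fano_lines | x \in l].
    by apply/setIdP; rewrite imset_f // mem_fano_line.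
  have := sub _ jx; rewrite in_set => /mapP[l lls eqj].
  rewrite has_map; apply/hasP; exists l => //=.
  by have := fano_lineE l (Ordinal ltj7); rewrite eqj eqxx /eq_mem_seq andbC => <-.
move=> /setIdP[/imsetP[j _ ->]]; rewrite mem_fano_line => xj.
have := sub (fano_seq j) (map_f _ _); rewrite mem_iota ltn_ord xj => /(_ isT).
rewrite has_map => /hasP[l lls /=].
rewrite /eq_mem_seq andbC => eqj; have := fano_lineE l j.
rewrite /eq_mem_seq eqj inE => /eqP<-.
exact: map_f.
Qed.

Lemma is_vertexE (t : tuple7) : is_vertex t = is_frame (map7 val t).
Proof.
case: t => [[[[[[x b1] c1] b2] c2] b0] c0].
pose ls := [:: [:: x; b1; c1]; [:: x; b2; c2]; [:: x; b0; c0]].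
rewrite /is_vertex !set3E mem_fano_lines.
(* The explicit lists are refolded as maps over [ls], the shape that [fano_pencilE] and
   [pairwise_map] expect. *)
rewrite -[uniq _]/(uniq (map (fun l => [set:: l]) ls)).
rewrite -[X in X == _]/([set:: map (fun l => [set:: l]) ls]).
rewrite fano_pencilE; last by rewrite /= !inE !eqxx.
rewrite uniq_pairwise pairwise_map.
pose nls : seq (seq nat) := map (map val) ls.
rewrite -[RHS]/([&& pairwise (fun l l' => ~~ eq_mem_seq l l') nls,
  all is_line nls,
  all (fun l : seq nat => (val x \in l) ==> has (eq_mem_seq l) nls) fano_seqs
  & is_line (map val [:: b1; b2; b0])]).
rewrite /nls pairwise_map -andbA; congr (_ && _).
by rewrite /= !eq_mem_seqP -!(eq_mem_seq_map _ _ val_inj).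
Qed.

(** * The orbit of a base frame, and why it consists of all vertices *)

Definition base_frame : tuple7_of nat := (0, 1, 3, 2, 6, 4, 5)%N.

(** Breadth-first search; eight rounds suffice, since [reach_succ7] checks that the result is closed
    under the steps. *)
Definition reach_list : seq (tuple7_of nat) :=
  iter 8 (fun s => undup (s ++ [seq succ7 i t | i <- iota 0 3, t <- s]))
    [:: base_frame].

(* Locked: unification would otherwise try to evaluate it. *)
Definition reach : seq (tuple7_of nat) := locked reach_list.

Lemma reachE : reach = reach_list.
Proof. by rewrite /reach -lock. Qed.

Lemma reach_frame : all is_frame reach.
Proof. by rewrite reachE; vm_compute. Qed.

Lemma reach_succ7 :
  all (fun t => all (fun i => succ7 i t \in reach) (iota 0 3)) reach.
Proof. by rewrite reachE; vm_compute. Qed.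

(** The pair of index i moves to index i + 1 modulo 3. *)
Definition rot7 (T : Type) (t : tuple7_of T) : tuple7_of T :=
  let: (x, b1, c1, b2, c2, b0, c0) := t in (x, b0, c0, b1, c1, b2, c2).

Lemma map7_rot7 (T U : Type) (f : T -> U) t : map7 f (rot7 t) = rot7 (map7 f t).
Proof. by case: t => [[[[[[x b1] c1] b2] c2] b0] c0]. Qed.

Lemma rot7_succ7 (T : Type) (i : 'Z_3) (t : tuple7_of T) :
  rot7 (succ7 i t) = succ7 (i + 1)%R (rot7 t).
Proof.
by case: t => [[[[[[x b1] c1] b2] c2] b0] c0]; case: i => [[|[|[|]]]].
Qed.

Lemma rot7K (T : Type) (t : tuple7_of T) : rot7 (rot7 (rot7 t)) = t.
Proof. by case: t => [[[[[[x b1] c1] b2] c2] b0] c0]. Qed.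

Lemma succ7K (T : Type) i (t : tuple7_of T) :
  succ7 i (succ7 i (succ7 i (succ7 i t))) = t.
Proof. by case: t => [[[[[[x b1] c1] b2] c2] b0] c0]; case: i => [|[|]]. Qed.

Lemma reach_rot7 : all (fun t => rot7 t \in reach) reach.
Proof. by rewrite reachE; vm_compute. Qed.

Lemma reach_entries_uniq : all (fun t => uniq (seq7 t)) reach.
Proof. by rewrite reachE; vm_compute. Qed.

Lemma reach_lt7 : all (fun t => all (ltn^~ 7) (seq7 t)) reach.
Proof. by rewrite reachE; vm_compute. Qed.

Lemma size_reach : size reach = 168%N.
Proof. by rewrite reachE; vm_compute. Qed.

Lemma reach_uniq : uniq reach.
Proof. by rewrite reachE /reach_list iterS undup_uniq. Qed.

Lemma reach_ind (P : tuple7_of nat -> Prop) :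
  P base_frame -> (forall i t, (i < 3)%N -> P t -> P (succ7 i t)) ->
  forall t, t \in reach -> P t.
Proof.
move=> P0 PS; rewrite reachE /reach_list; elim: 8%N => [|n IHn] t.
  by rewrite inE => /eqP->.
rewrite iterS mem_undup mem_cat => /orP[/IHn// | ].
case/allpairsP=> -[i u] []; rewrite mem_iota => lti3 /IHn Pu ->.
exact: PS.
Qed.

Lemma base_frame_reach : base_frame \in reach.
Proof. by rewrite reachE; vm_compute. Qed.

(* Nested conditionals rather than a filter over all tuples: this prunes the
   7^7 candidates to a few thousand tests. *)
Definition frames_in (pts : seq nat) (r : seq (tuple7_of nat)) : bool :=
  all (fun x => all (fun b1 => all (fun c1 =>
    if ~~ is_line [:: x; b1; c1] then true else
    all (fun b2 => all (fun c2 =>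
      if ~~ is_line [:: x; b2; c2] then true else
      if eq_mem_seq [:: x; b1; c1] [:: x; b2; c2] then true else
      all (fun b0 =>
        if ~~ is_line [:: b1; b2; b0] then true else
        all (fun c0 =>
          if ~~ is_line [:: x; b0; c0] then true else
          if eq_mem_seq [:: x; b1; c1] [:: x; b0; c0] then true else
          if eq_mem_seq [:: x; b2; c2] [:: x; b0; c0] then true else
          (x, b1, c1, b2, c2, b0, c0) \in r)
      pts) pts) pts) pts) pts) pts) pts.

Lemma frames_in_reach : frames_in (iota 0 7) reach.
Proof. by rewrite reachE; vm_compute. Qed.

Lemma frames_inP pts r t :
  frames_in pts r -> all (mem pts) (seq7 t) -> is_frame t -> t \in r.
Proof.
case: t => [[[[[[x b1] c1] b2] c2] b0] c0] /= Hr.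
case/and5P=> ltx ltb1 ltc1 ltb2 /and4P[ltc2 ltb0 ltc0 _].
case/and4P; rewrite /= !andbT -andbA => /and3P[d12 d10 d20] /and3P[l1 l2 l0] _ lb.
move: Hr => /allP/(_ _ ltx)/allP/(_ _ ltb1)/allP/(_ _ ltc1); rewrite l1.
move=> /allP/(_ _ ltb2)/allP/(_ _ ltc2); rewrite l2 (negPf d12).
move=> /allP/(_ _ ltb0); rewrite lb => /allP/(_ _ ltc0).
by rewrite l0 (negPf d10) (negPf d20).
Qed.

(** Bridge from the definition to the enumeration: closure properties of the vertex set become
    finite checks on [reach]. *)
Lemma vertex_reach (t : tuple7) : is_vertex t = (map7 val t \in reach).
Proof.
rewrite is_vertexE; apply/idP/idP => [|/(allP reach_frame)//].
apply: frames_inP frames_in_reach _.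
rewrite seq7_map all_map; apply/allP=> z _.
by rewrite -[preim _ _ _]/(val z \in iota 0 7) mem_iota ltn_ord.
Qed.

Lemma succ7_vertex (i : 'Z_3) (t : tuple7) :
  is_vertex t -> is_vertex (succ7 i t).
Proof.
rewrite !vertex_reach map7_succ7 => /(allP reach_succ7)/allP; apply.
by rewrite mem_iota ltn_ord.
Qed.

Lemma rot7_vertex (t : tuple7) : is_vertex t -> is_vertex (rot7 t).
Proof. by rewrite !vertex_reach map7_rot7 => /(allP reach_rot7). Qed.

Lemma vertex_uniq (v : vertex) : uniq (seq7 (val v)).
Proof.
have := valP v; rewrite vertex_reach => /(allP reach_entries_uniq).
by rewrite seq7_map map_inj_uniq //; apply: val_inj.
Qed.

Lemma map7_val_inj : injective (map7 (val : 'Z_7 -> nat)).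
Proof.
move=> t t' eqt; apply: seq7_inj; apply: (inj_map val_inj).
by rewrite -!seq7_map eqt.
Qed.

Lemma reach_val (u : tuple7_of nat) :
  u \in reach -> map7 val (map7 (inZp : nat -> 'Z_7) u) = u.
Proof.
move/(allP reach_lt7) => ltu; apply: seq7_inj; rewrite !seq7_map -map_comp.
by apply: map_id_in => z /(allP ltu) /= ltz7; rewrite modn_small.
Qed.

Lemma card_vertex : #|vertex| = 168%N.
Proof.
rewrite card_sig -size_reach -(size_map (map7 (inZp : nat -> 'Z_7))).
rewrite -(card_uniqP _); last first.
  rewrite map_inj_in_uniq ?reach_uniq // => u u' Ru Ru' eqp.
  by rewrite -(reach_val Ru) eqp reach_val.
apply: eq_card => t; rewrite !inE vertex_reach; apply/idP/mapP => [Rt | [u Ru ->]].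
  by exists (map7 val t) => //; apply: map7_val_inj; rewrite reach_val.
by rewrite reach_val.
Qed.

(** * Arcs as steps, strong connectivity and transitivity *)

Definition step (i : 'Z_3) (v : vertex) : vertex :=
  exist _ (succ7 i (val v)) (succ7_vertex i (valP v)).

Lemma arcDE v w : arcD v w = [exists i, w == step i v].
Proof.
apply: eq_existsb => i; rewrite /vx /vb /vc.
have -> : (w == step i v) = (val w == succ7 i (val v)) by [].
case: (val v) => [[[[[[x b1] c1] b2] c2] b0] c0].
case: (val w) => [[[[[[x' b1'] c1'] b2'] c2'] b0'] c0'].
(* The point [x] serves only as default value for [nth]. Once the index is fixed, both sides are
   conjunctions of the same seven equations in different orders. *)
rewrite !(tnth_nth x) (eq_sym x).
by case: i => [[|[|[|]]]] // ? /=; rewrite !xpair_eqE;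
  do ![case: (_ == _) => //=].
Qed.

Lemma arcDP v w : reflect (exists i, w = step i v) (arcD v w).
Proof. by rewrite arcDE; apply: (iffP existsP) => -[i e]; exists i; apply/eqP. Qed.

Lemma arcD_step i v : arcD v (step i v).
Proof. by apply/arcDP; exists i. Qed.

Lemma stepK i v : step i (step i (step i (step i v))) = v.
Proof. by apply: val_inj; rewrite /= succ7K. Qed.

Lemma vertex_ind_base (P : vertex -> Prop) :
  (forall u, map7 val (val u) = base_frame -> P u) ->
  (forall i u, P u -> P (step i u)) -> forall v, P v.
Proof.
move=> P0 PS v; have := valP v; rewrite vertex_reach => Rv.
pose Q t := forall u : vertex, map7 val (val u) = t -> P u.
apply: (@reach_ind Q _ _ _ Rv) => // i t lti3 IHt u eu.
(* Three further steps of the same index lead from [u] back to the vertex lying over [t]. *)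
rewrite -(stepK (Ordinal lti3) u); apply/PS/IHt.
by rewrite /= !map7_succ7 eu succ7K.
Qed.

(** Any vertex can start the induction. This is itself proved by induction on [u]: a step is undone
    by three more steps, so [P] passes from [step i u] back to [u]. *)
Lemma vertex_ind u (P : vertex -> Prop) :
  P u -> (forall i v, P v -> P (step i v)) -> forall v, P v.
Proof.
move=> Pu PS; suff Pbase: forall w, map7 val (val w) = base_frame -> P w.
  exact: vertex_ind_base.
move: u P Pu PS; apply: vertex_ind_base => [u eu P Pu _ w ew|i u IHu P Pu PS].
  suff -> : w = u by [].
  by apply/val_inj/map7_val_inj; rewrite ew.
by apply: IHu => //; rewrite -(stepK i u); do 3!apply: (PS i).
Qed.

Lemma strongly_connected_arcD : strongly_connected arcD.
Proof.
move=> x; apply: (@vertex_ind x) => [|i v]; first exact: connect0.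
by move/connect_trans; apply; apply/connect1/arcD_step.
Qed.

(** The relabelling sends the entries of [u] to those of [w] position by position. It maps vertices
    to vertices because it does so at [u] and this propagates along the steps by naturality. *)
Lemma exists_translation (u w : vertex) :
  exists2 g : vertex -> vertex,
    g u = w & forall i v, g (step i v) = step i (g v).
Proof.
(* Well matched because the seven entries of [u] are distinct. *)
pose f z := nth 0 (seq7 (val w)) (index z (seq7 (val u))).
have fu : map7 f (val u) = val w.
  apply: seq7_inj; rewrite seq7_map.
  apply: (@eq_from_nth _ 0) => [|k]; rewrite size_map ?size_seq7 // => ltk.
  by rewrite (nth_map 0) ?size_seq7 // /f index_uniq ?size_seq7 ?vertex_uniq.
have vf : forall v : vertex, is_vertex (map7 f (val v)).
  apply: (@vertex_ind u) => [|i v IHv]; first by rewrite fu (valP w).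
  by rewrite /= map7_succ7 succ7_vertex.
exists (fun v => exist is_vertex _ (vf v)); first exact/val_inj.
by move=> i v; apply: val_inj; rewrite /= map7_succ7.
Qed.

(** * Closed walks of length at most 4 *)

Definition walk (s : seq 'Z_3) (v : vertex) : vertex :=
  foldl (fun u i => step i u) v s.

(* Translations commute with the steps, so whether a walk is closed does not
   depend on where it starts. *)
Lemma closed_walk_base s v : walk s v = v ->
  foldl (fun t i => succ7 i t) base_frame (map val s) = base_frame.
Proof.
have [u eu]: exists u : vertex, map7 val (val u) = base_frame.
  suff bV: is_vertex (map7 inZp base_frame).
    by exists (exist is_vertex _ bV); apply: reach_val base_frame_reach.
  by rewrite vertex_reach reach_val base_frame_reach.
have [g gv gS] := exists_translation v u.
move=> /(congr1 g); rewrite gv.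
have -> : g (walk s v) = walk s u.
  by rewrite -gv /walk; elim: s v {gv} => //= i s IHs v; rewrite IHs gS.
move=> eqs; rewrite -eu -[in RHS]eqs; elim: s (u) {eqs} => //= i s IHs w.
by rewrite -IHs /= map7_succ7.
Qed.

Lemma closed_walk2 i j v : step j (step i v) <> v.
Proof.
by move/(@closed_walk_base [:: i; j]); case: i j => [[|[|[|]]]] // ? [[|[|[|]]]].
Qed.

Lemma closed_walk3 i j k v : step k (step j (step i v)) <> v.
Proof.
move/(@closed_walk_base [:: i; j; k]).
by case: i j k => [[|[|[|]]]] // ? [[|[|[|]]]] // ? [[|[|[|]]]].
Qed.

(** All 81 index words are run on the base frame; only the constant ones return to it. *)
Lemma closed_walk4 i j k l v : step l (step k (step j (step i v))) = v ->
  [/\ j = i, k = i & l = i].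
Proof.
move/(@closed_walk_base [:: i; j; k; l]) => /= H.
suff /and3P[/eqP ? /eqP ? /eqP ?] : [&& j == i, k == i & l == i] by [].
move: H; rewrite -!val_eqE.
by case: i j k l => [[|[|[|]]]] // ? [[|[|[|]]]] // ? [[|[|[|]]]] // ? [[|[|[|]]]].
Qed.

(** If [step i v = step j v], the index word j, i, i, i closes up at [v], so it must be constant. *)
Lemma step_idx_inj v : injective (step^~ v).
Proof.
move=> i j /= eqij; have := stepK i v; rewrite eqij.
by case/closed_walk4.
Qed.

Lemma arc_inj i j v w : (v, step i v) = (w, step j w) -> v = w /\ i = j.
Proof.
move=> eqp; have evw : v = w := congr1 fst eqp; split=> //.
have /= := congr1 snd eqp; rewrite -evw; exact: step_idx_inj.
Qed.

(** * Orientation, degrees, and absence of directed 2- and 3-cycles *)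

Lemma oriented_arcD : oriented arcD.
Proof.
split=> [v | v w /arcDP[i ->]].
  by apply/negbTE/negP=> /arcDP[i ev]; apply: (@closed_walk2 i i v); rewrite -!ev.
by apply/negP=> /arcDP[j /esym/closed_walk2].
Qed.

Lemma degrees_arcD v : indegree arcD v = 3%N /\ outdegree arcD v = 3%N.
Proof.
split.
  rewrite /indegree -[3%N]card_ord.
  (* The inverse of [step i] is its cube. A coincidence of two predecessors of [v] gives one vertex
     whose steps of indices [i] and [j] both end at [v]. *)
  pose pred_step (u : vertex) i := step i (step i (step i u)).
  rewrite -(card_imset _ (f := pred_step v)); last first.
    move=> i j eqij; apply: (@step_idx_inj (pred_step v i)).
    by rewrite /= [LHS]stepK eqij stepK.
  apply: eq_card => w; rewrite inE; apply/arcDP/imsetP => [[i ->] | [i _ ->]].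
    by exists i; rewrite /pred_step ?stepK.
  by exists i; rewrite /pred_step stepK.
rewrite /outdegree -[3%N]card_ord -(card_imset _ (@step_idx_inj v)).
apply: eq_card => w; rewrite inE.
by apply/arcDP/imsetP => [[i ->] | [i _ ->]]; exists i.
Qed.

Lemma dicyclesP (T : finType) (e : rel T) n (C : {set T * T}) :
  reflect (exists t : n.-tuple T, [/\ cycle e t, uniq t & C = cycle_arcs t])
    (C \in dicycles e n).
Proof.
by apply: (iffP imsetP) => [[t + ->] | [t [et ut ->]]];
  [rewrite inE => /andP[]|]; exists t; rewrite ?inE /ucycleb ?et.
Qed.

Lemma cycle2 (T : eqType) (e : rel T) x y :
  cycle e [:: x; y] = e x y && e y x.
Proof. by rewrite /= andbT. Qed.

Lemma cycle3 (T : eqType) (e : rel T) x y z :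
  cycle e [:: x; y; z] = [&& e x y, e y z & e z x].
Proof. by rewrite /= andbT. Qed.

Lemma cycle4 (T : eqType) (e : rel T) x y z t :
  cycle e [:: x; y; z; t] = [&& e x y, e y z, e z t & e t x].
Proof. by rewrite /= andbT. Qed.

Lemma dicycles2 : dicycles arcD 2 = set0.
Proof.
apply/eqP/set0Pn => -[C /dicyclesP[[[|x [|y []]] // szt] [+ _ _]]].
rewrite cycle2 => /andP[/arcDP[i ->] /arcDP[j]].
by move/esym/closed_walk2.
Qed.

Lemma dicycles3 : dicycles arcD 3 = set0.
Proof.
apply/eqP/set0Pn => -[C /dicyclesP[[[|x [|y [|z []]]] // szt] [+ _ _]]].
rewrite cycle3 => /and3P[/arcDP[i ->] /arcDP[j ->] /arcDP[k]].
by move/esym/closed_walk3.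
Qed.

Lemma arcs_closed_walk4 v a b c : arcD v a -> arcD a b -> arcD b c -> arcD c v ->
  exists i, [/\ a = step i v, b = step i a, c = step i b & v = step i c].
Proof.
move=> /arcDP[i ->] /arcDP[j ->] /arcDP[k ->] /arcDP[l /esym/closed_walk4].
by case=> -> -> _; exists i; rewrite stepK.
Qed.

(** * The directed 4-cycles as orbits of the steps *)

Definition cyc (i : 'Z_3) (v : vertex) : {set vertex * vertex} :=
  [set (x, step i x) | x in traject (step i) v 4].

Lemma iter_step_mod i k v : iter k (step i) v = iter (k %% 4) (step i) v.
Proof.
rewrite [in LHS](divn_eq k 4) addnC iterD; congr iter.
by elim: (k %/ 4)%N => // m IHm; rewrite mulSn iterD IHm /= stepK.
Qed.

Lemma traject_stepP i v x :
  reflect (exists k, x = iter k (step i) v) (x \in traject (step i) v 4).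
Proof.
apply: (iffP trajectP) => [[k _ ->] | [k ->]]; first by exists k.
by exists (k %% 4)%N; rewrite ?ltn_pmod // iter_step_mod.
Qed.

Lemma traject_step_eq i v x : x \in traject (step i) v 4 ->
  traject (step i) x 4 =i traject (step i) v 4.
Proof.
case/traject_stepP=> k -> y; apply/traject_stepP/traject_stepP => -[m ->].
  by exists (m + k)%N; rewrite iterD.
(* Since the step has order dividing 4, [3 * k] further iterations undo [k] of them. *)
exists (m + 3 * k)%N; rewrite -iterD -addnA -mulSnr iterD; congr iter.
by rewrite iter_step_mod modnMr.
Qed.

Lemma mem_cyc i v : (v, step i v) \in cyc i v.
Proof.
apply/imsetP; exists v => //.
exact: mem_head.
Qed.

(** An arc determines its tail and its index, hence the whole orbit containing it. *)
Lemma cyc_meet i j v w p : p \in cyc i v -> p \in cyc j w -> cyc i v = cyc j w.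
Proof.
case/imsetP=> x xv -> /imsetP[y yw eqp].
have [exy eij] := arc_inj eqp.
rewrite -{}eij -{}exy in yw *.
have xvw z : (z \in traject (step i) v 4) = (z \in traject (step i) w 4).
  by rewrite -(traject_step_eq xv) (traject_step_eq yw).
by apply/setP=> q; apply/imsetP/imsetP => -[z zt ->];
  exists z; rewrite // ?xvw // -xvw.
Qed.

Lemma uniq_traject4 (T : eqType) (f : T -> T) x :
  (forall y, f y <> y) -> (forall y, f (f y) <> y) ->
  (forall y, f (f (f y)) <> y) -> uniq (traject f x 4).
Proof.
move=> f1 f2 f3; rewrite /= !inE !negb_or andbT.
have n1 y : y != f y by rewrite eq_sym; apply/eqP/f1.
have n2 y : y != f (f y) by rewrite eq_sym; apply/eqP/f2.
have n3 y : y != f (f (f y)) by rewrite eq_sym; apply/eqP/f3.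
by rewrite !n1 !n2 !n3.
Qed.

Lemma uniq_traject_step i v : uniq (traject (step i) v 4).
Proof.
apply: uniq_traject4 => w; [move=> ew | exact: closed_walk2 | exact: closed_walk3].
(* A fixed point would also be fixed by two steps. *)
by apply: (@closed_walk2 i i w); rewrite !ew.
Qed.

Lemma card_imset_seq (T U : finType) (f : T -> U) (s : seq T) :
  injective f -> uniq s -> #|[set f x | x in s]| = size s.
Proof. by move=> f_inj /card_uniqP <-; apply: card_imset. Qed.

Lemma card_cyc i v : #|cyc i v| = 4%N.
Proof.
rewrite -[RHS](size_traject (step i) v 4).
apply: card_imset_seq; last exact: uniq_traject_step.
by move=> x y /arc_inj[].
Qed.

Lemma cycle_arcs_fcycle (T : finType) (f : T -> T) (s : seq T) :
  fcycle f s -> cycle_arcs s = [set (x, f x) | x in s].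
Proof.
by move=> fs; apply: eq_in_imset => x xs; rewrite (nextE fs xs).
Qed.

Lemma fcycle_traject4 (T : eqType) (f : T -> T) x :
  f (f (f (f x))) = x -> fcycle f (traject f x 4).
Proof. by move=> fx; rewrite /= !eqxx fx eqxx. Qed.

Lemma cycle_arcs_traject i v : cycle_arcs (traject (step i) v 4) = cyc i v.
Proof.
by apply/cycle_arcs_fcycle/fcycle_traject4/stepK.
Qed.

Lemma dicycles4P (C : {set vertex * vertex}) :
  reflect (exists i v, C = cyc i v) (C \in dicycles arcD 4).
Proof.
apply: (iffP (dicyclesP _ _ _)) => [[t [ct _ ->]] | [i [v ->]]].
  case: t ct => -[|x [|y [|z [|t []]]]] // szt; rewrite cycle4.
  case/and4P=> a1 a2 a3 a4.
  have [i [ey ez et _]] := arcs_closed_walk4 a1 a2 a3 a4.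
  by exists i, x; rewrite -cycle_arcs_traject et ez ey.
exists [tuple of traject (step i) v 4]; split; last by rewrite cycle_arcs_traject.
  by rewrite cycle4 !arcD_step -[X in arcD _ X](stepK i v) arcD_step.
exact: uniq_traject_step.
Qed.

Lemma dicycles4_disjoint (C C' : {set vertex * vertex}) :
  C \in dicycles arcD 4 -> C' \in dicycles arcD 4 -> C <> C' -> [disjoint C & C'].
Proof.
move=> /dicycles4P[i [v ->]] /dicycles4P[j [w ->]] neq.
by apply/pred0P => p /=; apply/negP=> /andP[pv /(cyc_meet pv)].
Qed.

Lemma card_arcs : #|[set p | arcD p.1 p.2]| = (168 * 3)%N.
Proof.
rewrite -card_vertex -[3%N]card_ord -card_prod.
rewrite -[RHS](card_imset _ (f := fun p : vertex * 'Z_3 => (p.1, step p.2 p.1))).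
  apply: eq_card => -[v w]; rewrite inE.
  apply/arcDP/imsetP => /= [[i ->]|[[u i] _ [-> ->]]].
    by exists (v, i).
  by exists i.
by move=> [v i] [w j] /= /arc_inj[-> ->].
Qed.

(** The 4-cycles partition the 504 arcs into blocks of size 4, and 504 / 4 = 126. *)
Lemma card_dicycles4 : #|dicycles arcD 4| = 126%N.
Proof.
have part : partition (dicycles arcD 4) [set p | arcD p.1 p.2].
  apply/and3P; split.
  - rewrite eqEsubset; apply/andP; split; apply/subsetP=> p.
      case/bigcupP=> C /dicycles4P[i [v ->]] /imsetP[x _ ->].
      by rewrite inE arcD_step.
    case: p => v w; rewrite inE => /arcDP[i /= ->].
    apply/bigcupP; exists (cyc i v); first by apply/dicycles4P; exists i, v.
    exact: mem_cyc.
  - by apply/trivIsetP=> C C' HC HC' /eqP; apply: dicycles4_disjoint.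
  - apply/negP=> /dicycles4P[i [v e0]].
    by have := card_cyc i v; rewrite -e0 cards0.
have := card_uniform_partition (n := 4) _ part; rewrite card_arcs => card4.
apply/eqP; rewrite -(eqn_pmul2r (isT : 0 < 4)%N) -card4 // => C.
by case/dicycles4P=> i [v ->]; apply: card_cyc.
Qed.

(** * Automorphisms and ultrahomogeneity *)

Definition rot_vertex (v : vertex) : vertex :=
  exist _ (rot7 (val v)) (rot7_vertex (valP v)).

Lemma rot_vertex_step i v : rot_vertex (step i v) = step (i + 1) (rot_vertex v).
Proof. by apply: val_inj; rewrite /= rot7_succ7. Qed.

Lemma iter_rot_vertex_step m i v :
  iter m rot_vertex (step i v) = step (i + m%:R) (iter m rot_vertex v).
Proof.
elim: m => [|m IHm]; first by rewrite addr0.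
by rewrite !iterS IHm rot_vertex_step -addrA natr1.
Qed.

Lemma step_conj_auto (g : vertex -> vertex) (h : 'Z_3 -> 'Z_3) :
  injective g -> bijective h -> (forall i v, g (step i v) = step (h i) (g v)) ->
  digraph_iso arcD arcD g.
Proof.
move=> g_inj [h' hK h'K] gS; split; first exact: injF_bij.
move=> v w; apply/arcDP/arcDP => [[i eqw] | [i ->]]; last by exists (h i).
by exists (h' i); apply: g_inj; rewrite eqw gS h'K.
Qed.

(** Rotating [j - i] times turns [step i] into [step j]; a translation then carries the rotated [u]
    to [w] without changing indices. *)
Lemma exists_auto (u w : vertex) (i j : 'Z_3) :
  exists g : vertex -> vertex,
    [/\ digraph_iso arcD arcD g, g u = w
      & forall v, g (step i v) = step j (g v)].
Proof.
pose m := nat_of_ord (j - i); pose r := iter m rot_vertex.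
have [g gu gS] := exists_translation (r u) w.
have [g' g'w g'S] := exists_translation w (r u).
(* The composite fixes [r u] and commutes with all steps, so it fixes every vertex. *)
have gK : cancel g g'.
  by apply: (@vertex_ind (r u)) => [|k v IHv]; rewrite ?gu // gS g'S IHv.
have r_inj : injective r.
  rewrite /r; elim: m {r gu g'w gK} => [|m IHm] //= v v' /= eqr; apply: IHm.
  (* Two more rotations complete a full turn, which is the identity. *)
  move/(congr1 (rot_vertex \o rot_vertex)): eqr => /(congr1 val) /=.
  by rewrite !rot7K => /val_inj.
have grS k v : g (r (step k v)) = step (k + (j - i)) (g (r v)).
  have mE : m%:R = j - i :> 'Z_3 by rewrite /m natr_Zp.
  by rewrite /r iter_rot_vertex_step gS mE.
exists (g \o r); split=> //; last by move=> v; rewrite /= grS addrC subrK.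
apply: (step_conj_auto (h := fun k => k + (j - i))) => [| |k v]; last exact: grS.
  exact: inj_comp (can_inj gK) r_inj.
by exists (fun k => k - (j - i)) => k; rewrite ?addrK ?subrK.
Qed.

Lemma closed_path_step (p : 'Z_4 -> vertex) :
  (forall k, arcD (p k) (p (k + 1))) ->
  exists i, forall k, p (k + 1) = step i (p k).
Proof.
move=> pS; have E4 : 0 + 1 + 1 + 1 + 1 = 0 :> 'Z_4 by apply: val_inj.
have := pS (0 + 1 + 1 + 1); rewrite E4 => a4.
have [i [p1 p2 p3 p4]] := arcs_closed_walk4 (pS _) (pS _) (pS _) a4.
exists i => -[[|[|[|[|//]]]] lt4].
- by rewrite (_ : Ordinal lt4 = 0) //; apply: val_inj.
- by rewrite (_ : Ordinal lt4 = 0 + 1) //; apply: val_inj.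
- by rewrite (_ : Ordinal lt4 = 0 + 1 + 1) //; apply: val_inj.
by rewrite (_ : Ordinal lt4 = 0 + 1 + 1 + 1) ?E4 //; apply: val_inj.
Qed.

(** Reading [A] along ['Z_4] through [a] gives a closed walk with constant index [i]; its image
    under [f] is one with constant index [j]. An automorphism that agrees with [f] at [a 0] and
    turns [step i] into [step j] therefore agrees with [f] all the way round. *)
Lemma ultrahomogeneous_arcD : ultrahomogeneous dicycle4 arcD.
Proof.
move=> A B [h [[a hK aK] hA]] _ f [_ fA].
have aS k : arcD (val (a k)) (val (a (k + 1))).
  by have := hA (a k) (a (k + 1)); rewrite !aK /dicycle4 eqxx /induced => <-.
have faS k : arcD (val (f (a k))) (val (f (a (k + 1)))).
  by have := fA (a k) (a (k + 1)); rewrite /induced aS.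
have [i aiS] := closed_path_step aS; have [j fajS] := closed_path_step faS.
have [g [g_auto g0 gS]] := exists_auto (val (a 0)) (val (f (a 0))) i j.
exists g => // x; rewrite -(hK x) -[h x]natr_Zp.
elim: (nat_of_ord (h x)) => [|n IHn]; first exact: g0.
by rewrite -natr1 aiS gS IHn fajS.
Qed.

Local Close Scope ring_scope.

Theorem theorem1 :
  strongly_connected arcD /\
  oriented arcD /\
  #|vertex| = 168 /\
  (forall v : vertex, indegree arcD v = 3 /\ outdegree arcD v = 3) /\
  dicycles arcD 2 = set0 /\
  dicycles arcD 3 = set0 /\
  #|dicycles arcD 4| = 126 /\
  (forall C C' : {set vertex * vertex},
     C \in dicycles arcD 4 -> C' \in dicycles arcD 4 ->
     C <> C' -> [disjoint C & C']) /\
  ultrahomogeneous dicycle4 arcD.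
Proof.
split; first exact: strongly_connected_arcD.
split; first exact: oriented_arcD.
split; first exact: card_vertex.
split; first exact: degrees_arcD.
split; first exact: dicycles2.
split; first exact: dicycles3.
split; first exact: card_dicycles4.
by split; [exact: dicycles4_disjoint | exact: ultrahomogeneous_arcD].
Qed.
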